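(* Let $G$ be a modular abelian independence group and let $A,B$ be finite-rank flats of $G$ satisfying $$\rho(A)=\rho(B)=n<\mu(G)\qquad\text{and}\qquad 1\notin B.$$ Then $A$ is matched to $B$.
   Context: A finitary matroid is a pair $(E,\mathcal{I})$ consisting of a set $E$ and a nonempty collection $\mathcal{I}$ of subsets of $E$ (called the independent sets) such that: (I1) if $A\in\mathcal{I}$ and $B\subseteq A$ then $B\in\mathcal{I}$; (I2) if $A,B$ are finite elements of $\mathcal{I}$ with $|B|=|A|+1$, then there is $x\in B\setminus A$ with $\{x\}\cup A\in\mathcal{I}$; (I3) if $A\subseteq E$ and every finite subset of $A$ belongs to $\mathcal{I}$, then $A\in\mathcal{I}$. The collection $\mathcal{I}$ is called an independence structure on $E$. A basis of a subset $A\subseteq E$ is an inclusion-maximal independent subset of $A$; any two bases of $A$ have the same cardinality, and the rank $\rho(A)$ is that cardinal number; $A$ has finite rank, written $\rho(A)<\infty$, if $\rho(A)$ is a nonnegative integer. An element $x\in E$ depends on $A\subseteq E$ if either $x\in A$, or $x\notin A$ and $\{x\}\cup B\notin\mathcal{I}$ for some independent $B\subseteq A$. The closure is $\operatorname{cl}(A)=\{x\in E: x\text{ depends on }A\}$, and $A$ is a flat if $\operatorname{cl}(A)=A$. The finitary matroid is modular if $\rho(A)+\rho(B)=\rho(A\cup B)+\rho(A\cap B)$ (as cardinals) for all flats $A,B$. An independence group is a group $G$ (written multiplicatively, with identity $1$) together with an independence structure $\mathcal{I}$ on the set $G$ such that for every $g\in G$ and $A\subseteq G$ one has $gA\in\mathcal{I}$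 if and only if $A\in\mathcal{I}$, where $gA=\{gx:x\in A\}$. A modular abelian independence group is an independence group that is modular as a finitary matroid and whose group is abelian. A submonoid of $G$ is a subset containing $1$ and closed under multiplication. The submonoid-rank threshold of $G$ is $$\mu(G)=\min\Bigl(\bigl\{\rho(H):H\text{ is a submonoid of }G\text{ and }1<\rho(H)<\infty\bigr\}\cup\{\infty\}\Bigr).$$ Let $A,B$ be subsets of $G$ with $\rho(A)=\rho(B)$ finite. $A$ is matched to $B$ if for every basis $\mathcal{A}$ of $A$ and every basis $\mathcal{B}$ of $B$ there exists a bijection $f:\mathcal{A}\to\mathcal{B}$ such that $af(a)\notin A$ for all $a\in\mathcal{A}$. *)

(* Defs.v *)
From mathcomp Require Import all_boot all_order all_algebra.
From mathcomp Require Import all_classical constructive_ereal.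
Set Implicit Arguments.
Unset Strict Implicit.
Unset Printing Implicit Defensive.
Local Open Scope classical_set_scope.
Local Open Scope card_scope.

Record finitary_matroid (E : Type) := FinitaryMatroid {
  indep : set (set E);
  indep_nonempty : indep !=set0;
  indepI1 : forall A B, indep A -> B `<=` A -> indep B;
  indepI2 : forall (n : nat) (A B : set E), A #= `I_n -> B #= `I_n.+1 ->
    indep A -> indep B -> exists2 x, (B `\` A) x & indep (x |` A);
  indepI3 : forall A,
    (forall B, finite_set B -> B `<=` A -> indep B) -> indep A
}.

Section FinitaryMatroid.
Context (E : Type) (M : finitary_matroid E).
Implicit Types (A B S T : set E) (x : E) (n : nat).

Definition is_basis A S :=
  [/\ indep M S, S `<=` A &
      forall T, indep M T -> T `<=` A -> S `<=` T -> T = S].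

Definition has_rank A n := exists2 S, is_basis A S & S #= `I_n.

Definition depends_on x A :=
  A x \/ (~ A x /\ exists B, [/\ indep M B, B `<=` A & ~ indep M (x |` B)]).

Definition cl A : set E := [set x | depends_on x A].

Definition is_flat A := cl A = A.

(* The possibly infinite cardinals rho(A), ... are those of arbitrary bases of
   A, ..., and their sum is the cardinal of a disjoint union in E + E. *)
Definition modular := forall A B, is_flat A -> is_flat B ->
  forall SA SB SU SI, is_basis A SA -> is_basis B SB ->
    is_basis (A `|` B) SU -> is_basis (A `&` B) SI ->
  (inl @` SA `|` inr @` SB : set (E + E)) #=
  (inl @` SU `|` inr @` SI : set (E + E)).

End FinitaryMatroid.

Section IndependenceGroup.
Context (G : groupType) (M : finitary_matroid G).
Local Open Scope group_scope.

Definition translation_invariant := forall (g : G) (A : set G),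
  indep M [set g * x | x in A] <-> indep M A.

Definition submonoid_ranks : set (\bar int) :=
  [set n%:Z%:E%E | n in
     [set n : nat | (1 < n)%N /\ exists2 H : set G, monoid_closed (mem H) & has_rank M H n]].

(* The minimum exists because the natural numbers are well-ordered; the default
   value of [xget] is never used. *)
Definition submonoid_rank_threshold : \bar int :=
  let R := submonoid_ranks `|` [set +oo%E] in
  xget +oo%E [set m | R m /\ lbound R m].

Definition matched (A B : set G) := forall SA SB : set G,
  is_basis M A SA -> is_basis M B SB ->
  exists2 f : G -> G, set_bij SA SB f & forall a, SA a -> ~ A (a * f a).

End IndependenceGroup.

(* Main.v *)
Require Import Defs.
From mathcomp Require Import all_boot all_order all_algebra.
From mathcomp Require Import all_classical constructive_ereal.

(** Given bases a_1, ..., a_n of [A] and b_1, ..., b_n of [B], a matching is a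
    system of distinct representatives for the sets of those b_j with
    a_i b_j outside [A], so by Hall's marriage theorem ([hall_marriage]) it is
    enough to bound independent sets [S] in [A], nonempty, and [T] in [B] with
    [S] [T] inside [A]: they must satisfy |[S]| + |[T]| <= n
    ([indep_pair_bound]).

    Since [A] is a flat and translations preserve closure, the product of the
    closures of [S] and of [T] with 1 adjoined still lies in [A].  As 1 is outside the
    flat [B], adjoining it to [T] gives an independent set of size |[T]| + 1.  The bound is
    thus an instance of a Cauchy-Davenport inequality ([rank_mul]): if [U] and
    [W] are flats, [U] is nonempty, 1 is in [W], and [U] [W] lies in a flat of rank n below the
    submonoid threshold, then rank [U] + rank [W] <= n + 1.

    That inequality is proved by Dyson's e-transform, carried out on flats.
    For e in [U], replace [U] by the closure of the union of [U] and e[W], and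
    replace [W] by the intersection of [W] and e^-1 [U].  Commutativity keeps
    the product inside [A], and modularity applied to [U] and e[W] keeps the sum
    of the two ranks.  If some e[W] is not contained in [U], the rank of [W]
    drops, and one concludes by induction.  Otherwise [U] [W] is contained in
    [U], so [W] lies in the submonoid of all m with [U] m contained in [U].  This
    submonoid sits in a translate of [U], so its rank is at most n, hence at
    most 1 by the hypothesis on the threshold; then rank [W] <= 1 and the
    inequality holds because [U] is contained in [A]. *)

Set Implicit Arguments.
Unset Strict Implicit.
Unset Printing Implicit Defensive.

(** * Hall's marriage theorem *)

Section Hall.
Context (I J : finType).
Implicit Types (F : I -> {set J}) (K : {set I}).

Definition hall_condition F :=
  forall K, #|K| <= #|\bigcup_(i in K) F i|.

Definition shrink F i x := fun k => if k == i then F i :\ x else F k.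

Lemma shrink_cup F i x K : i \notin K ->
  \bigcup_(k in K) shrink F i x k = \bigcup_(k in K) F k.
Proof.
move=> iK; apply: eq_bigr => k kK; rewrite /shrink.
by case: eqP => // E; rewrite -E kK in iK.
Qed.

(** The set witnessing a failure of Hall's condition contains [i], the only index
    whose set has shrunk; it is recorded without [i], so that two such witnesses
    can be compared by submodularity. *)
Lemma shrink_violation F i x : hall_condition F ->
  ~~ [forall K : {set I}, #|K| <= #|\bigcup_(k in K) shrink F i x k|] ->
  exists2 K : {set I}, i \notin K &
    #|(F i :\ x) :|: \bigcup_(k in K) F k| <= #|K|.
Proof.
move=> hF /forallPn[K]; rewrite -ltnNge => ltK.
have iK : i \in K.
  by apply: contraLR ltK => iK; rewrite -leqNgt shrink_cup.
exists (K :\ i); first by rewrite !inE eqxx.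
move: ltK; rewrite (big_setD1 i iK) /= {1}/shrink eqxx shrink_cup; last first.
  by rewrite !inE eqxx.
by rewrite (cardsD1 i K) iK ltnS.
Qed.

(** Rado's argument: if neither [x] nor [y] could be removed from [F i], the two
    violations would bound the neighbourhoods of the index sets [Kx] and [Ky].
    The union of these neighbourhoods contains all of [F i], because [x] and [y]
    are distinct, and counting union and intersection contradicts Hall's
    condition for [i |: (Kx :|: Ky)] and [Kx :&: Ky]. *)
Lemma hall_shrink F i x y : hall_condition F -> x != y ->
  x \in F i -> y \in F i ->
  exists2 z, z \in F i & hall_condition (shrink F i z).
Proof.
move=> hF xy xi yi.
have [/forallP hx|/(shrink_violation hF)[Kx iKx cx]] := boolP
  [forall K : {set I}, #|K| <= #|\bigcup_(k in K) shrink F i x k|].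
  by exists x.
have [/forallP hy|/(shrink_violation hF)[Ky iKy cy]] := boolP
  [forall K : {set I}, #|K| <= #|\bigcup_(k in K) shrink F i y k|].
  by exists y.
pose N K := \bigcup_(k in K) F k.
have cU : #|i |: (Kx :|: Ky)| <= #|((F i :\ x) :|: N Kx) :|: ((F i :\ y) :|: N Ky)|.
  apply: leq_trans (hF _) (subset_leq_card _).
  apply/bigcupsP => k; rewrite !inE => /or3P[/eqP ->|kK|kK].
  - apply/fintype.subsetP => z zi; rewrite !inE zi.
    by have [->|] := eqVneq z x; rewrite ?xy ?orbT.
  - by rewrite -finset.setUA finset.setUCA; apply/finset.subsetU/orP; left; apply: finset.bigcup_sup.
  - by rewrite !finset.setUA; apply/finset.subsetU/orP; right; apply: finset.bigcup_sup.
have cI : #|Kx :&: Ky| <= #|((F i :\ x) :|: N Kx) :&: ((F i :\ y) :|: N Ky)|.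
  apply: leq_trans (hF _) (subset_leq_card _).
  apply/bigcupsP => k; rewrite inE => /andP[kx ky]; rewrite finset.subsetI.
  by apply/andP; split; apply/finset.subsetU/orP; right; apply: finset.bigcup_sup.
have := leq_add cU cI; rewrite cardsUI => h.
have := leq_trans h (leq_add cx cy).
by rewrite cardsU1 !inE (negPf iKx) (negPf iKy) -addnA cardsUI add1n ltnn.
Qed.

(** Removing elements while Hall's condition persists ends with singletons, and
    Hall's condition on pairs of indices makes these distinct. *)
Lemma hall_marriage F : hall_condition F ->
  exists2 f : I -> J, injective f & forall i, f i \in F i.
Proof.
have [n] := ubnP (\sum_i #|F i|); elim: n F => // n IH F ltn hF.
have F0 i : 0 < #|F i|.
  by have := hF [set i]; rewrite cards1 big_set1.
have [/forallP F1|/forallPn[i]] := boolP [forall i, #|F i| <= 1].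
  have /fin_all_exists[f fF] i : exists x, F i = [set x].
    by apply/cards1P; rewrite eqn_leq F1 F0.
  exists f => [i j fij|i]; last by rewrite fF inE.
  apply/eqP; apply: contraT => ij.
  have := hF [set i; j].
  by rewrite cards2 ij big_setU1 ?inE //= big_set1 !fF fij finset.setUid cards1.
rewrite -ltnNge => /card_gt1P[x [y [xi yi xy]]].
have [z zi hz] := hall_shrink hF xy xi yi.
have lt_shrink : \sum_k #|shrink F i z k| < n.
  apply: leq_trans (ltn : _ <= n); rewrite (bigD1 i) //= [X in _ < X](bigD1 i) //=.
  rewrite /shrink eqxx (cardsD1 z (F i)) zi add1n addSn ltnS leq_add2l.
  by apply: leq_sum => j /negPf ->.
have [f fI fz] := IH _ lt_shrink hz.
exists f => // i'; have := fz i'; rewrite /shrink; case: eqP => [->|//].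
by rewrite !inE => /andP[].
Qed.

End Hall.
(** * Finite cardinalities *)

Local Open Scope classical_set_scope.
Local Open Scope card_scope.

Lemma card_setU1 (T : Type) (A : set T) (x : T) n :
  A #= `I_n -> ~ A x -> x |` A #= `I_n.+1.
Proof.
by move=> An Ax; apply/eq_cardSP; exists x; [left|rewrite setUKD // => y [->]].
Qed.

Lemma card_sub_eq (T : Type) (A B : set T) n :
  A #= `I_n -> B #= `I_n -> A `<=` B -> A = B.
Proof.
move=> An Bn AB; apply/seteqP; split=> // x Bx; apply: contrapT => Ax.
have : x |` A `<=` B by move=> y [->|/AB].
move/subset_card_le.
by rewrite (card_le_eql (card_setU1 An Ax)) (card_le_eqr Bn) card_le_II ltnn.
Qed.

Lemma card_sum (S T : Type) (A : set S) (B : set T) p q :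
  A #= `I_p -> B #= `I_q -> (inl @` A `|` inr @` B : set (S + T)) #= `I_(p + q).
Proof.
move=> + Bq; elim: p A => [|p IH] A.
  rewrite II0 card_eq0 => /eqP ->; rewrite image_set0 set0U add0n.
  by apply: card_eq_trans Bq; apply: inj_card_eq => x y _ _ [].
move/eq_cardSP => [x Ax /IH Ap]; rewrite addSn; apply/eq_cardSP.
exists (inl x); first by left; exists x.
suff -> : (inl @` A `|` inr @` B) `\ (inl x) = inl @` (A `\ x) `|` inr @` B :> set (S + T) by [].
apply/seteqP; split=> [y [[[z Az <-]|[z Bz <-]] /= H]|y [[z [Az /= zx] <-]|[z Bz <-]]].
- by left; exists z => //; split=> // zx; apply: H; rewrite zx.
- by right; exists z.
- by split; [left; exists z|case].
- by split; [right; exists z|].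
Qed.

Lemma card_gt_sub (T : Type) (A : set T) n : ~ (A #<= `I_n) ->
  exists2 B, B #= `I_n.+1 & B `<=` A.
Proof.
move=> nA; apply/card_subP.
have [/finite_setP[m Am]|/infiniteP Ai] := pselect (finite_set A).
  move: nA; rewrite (card_le_eql Am) (card_le_eqr Am) !card_le_II.
  by move/negP; rewrite -ltnNge.
by apply: card_le_trans Ai; exact: subset_card_le.
Qed.

(** * Finite-rank theory of finitary matroids *)

Section Matroid.
Context (E : Type) (M : finitary_matroid E).
Implicit Types (A B S T X : set E) (x : E) (m n : nat).

Lemma basis_dependent A S x : is_basis M A S -> A x -> ~ S x ->
  ~ indep M (x |` S).
Proof.
move=> [iS SA maxS] Ax Sx /maxS E1; apply: Sx; rewrite -E1; first by left.
- by move=> y [->|/SA].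
- by move=> y; right.
Qed.

(** The rank is defined through the existence of one basis; exchange against that
    basis bounds every independent subset, finite or not. *)
Lemma indep_card A n T : has_rank M A n -> indep M T -> T `<=` A ->
  exists2 m, (m <= n)%N & T #= `I_m.
Proof.
move=> [S bS Sn] iT TA; have [iS SA _] := bS.
have Tn : T #<= `I_n.
  apply: contrapT => /card_gt_sub[B Bn BT].
  have [x [Bx Sx]] := indepI2 Sn Bn iS (indepI1 iT BT).
  by apply: (basis_dependent bS) => //; exact/TA/BT.
have /finite_setP[m Tm] : finite_set T by apply: card_le_finite Tn _.
by exists m => //; rewrite -card_le_II -(card_le_eql Tm).
Qed.

Lemma basis_extend A n X T : has_rank M A n -> X `<=` A ->
  indep M T -> T `<=` X ->
  exists m S, [/\ (m <= n)%N, is_basis M X S, T `<=` S & S #= `I_m].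
Proof.
move=> An XA iT TX.
pose P m := `[< exists S, [/\ indep M S, T `<=` S, S `<=` X & S #= `I_m] >].
have exP : exists m, P m.
  have [m _ Tm] := indep_card An iT (subset_trans TX XA).
  by exists m; apply/asboolP; exists T; split.
have leP m : P m -> (m <= n)%N.
  move=> /asboolP[S [iS _ SX Sm]].
  have [k kn Sk] := indep_card An iS (subset_trans SX XA).
  by move: Sk; rewrite (card_eql Sm) => /card_eq_II ->.
case: (ex_maxnP exP leP) => m /asboolP[S [iS TS SX Sm]] maxm.
exists m, S; split=> //.
  by apply: leP; apply/asboolP; exists S.
split=> // S' iS' S'X SS'.
have [k kn S'k] := indep_card An iS' (subset_trans S'X XA).
have km : (k <= m)%N.
  by apply: maxm; apply/asboolP; exists S'; split=> //; exact: subset_trans SS'.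
have mk : (m <= k)%N.
  by move/subset_card_le: SS'; rewrite (card_le_eql Sm) (card_le_eqr S'k) card_le_II.
have {mk km}E1 : m = k by apply/eqP; rewrite eqn_leq mk.
by rewrite -E1 in S'k; rewrite (card_sub_eq Sm S'k SS').
Qed.

Lemma set0_indep : indep M set0.
Proof. by case: (indep_nonempty M) => A iA; apply: indepI1 iA _. Qed.

Lemma sub_has_rank A n X : has_rank M A n -> X `<=` A ->
  exists2 m, (m <= n)%N & has_rank M X m.
Proof.
move=> An XA; have [//|m [S [mn bS _ Sm]]] :=
  basis_extend An XA set0_indep.
by exists m => //; exists S.
Qed.

Lemma rank_le A B p q : has_rank M A p -> has_rank M B q -> A `<=` B ->
  (p <= q)%N.
Proof.
move=> [S [iS SA _] Sp] Bq AB.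
have [m mq] := indep_card Bq iS (subset_trans SA AB).
by rewrite (card_eql Sp) => /card_eq_II ->.
Qed.

Lemma rank_uniq A p q : has_rank M A p -> has_rank M A q -> p = q.
Proof. by move=> Ap Aq; apply/eqP; rewrite eqn_leq !(rank_le Ap Aq, rank_le Aq Ap). Qed.

Lemma basis_card A S n : has_rank M A n -> is_basis M A S -> S #= `I_n.
Proof.
move=> An bS; have [iS SA _] := bS; have [m _ Sm] := indep_card An iS SA.
by rewrite (rank_uniq An (_ : has_rank M A m)) //; exists S.
Qed.

Lemma sub_cl A : A `<=` cl M A. Proof. by left. Qed.

Lemma cl_mono A B : A `<=` B -> cl M A `<=` cl M B.
Proof.
move=> AB x; have [Bx _|Bx [/AB //|[_ [S [iS SA dS]]]]] := pselect (B x).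
  exact: sub_cl.
by right; split=> //; exists S; split=> //; exact: subset_trans AB.
Qed.

Lemma cl_sub_flat A F : is_flat M F -> A `<=` F -> cl M A `<=` F.
Proof. by move=> fF /cl_mono; rewrite fF. Qed.

Lemma flatP F : cl M F `<=` F -> is_flat M F.
Proof. by move=> FF; apply/seteqP; split=> //; exact: sub_cl. Qed.

Lemma flatI F1 F2 : is_flat M F1 -> is_flat M F2 -> is_flat M (F1 `&` F2).
Proof.
by move=> f1 f2; apply: flatP; rewrite subsetI; split;
  apply: cl_sub_flat => // x [].
Qed.

(** [depends_on] asks for some independent subset of [A] that [x] makes dependent;
    it can always be taken to be any prescribed basis.  Indeed, if [x |` S] were
    independent, exchange would add to a basis containing a witness [B] an
    element of [x |` S], necessarily [x], making [x |` B] independent. *)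
Lemma cl_basisP A n S x : has_rank M A n -> is_basis M A S ->
  cl M A x <-> S x \/ ~ indep M (x |` S).
Proof.
move=> An bS; have [iS SA _] := bS; have Sn := basis_card An bS.
split=> [[Ax|[nAx [B [iB BA dB]]]]|].
- have [|nSx] := pselect (S x); [by left|right].
  exact: (basis_dependent bS).
- right=> iSx; apply: dB.
  have [m [B' [_ bB' BB' _]]] := basis_extend An (@subset_refl _ A) iB BA.
  have [iB' B'A _] := bB'; have B'n := basis_card An bB'.
  have nSx : ~ S x by move/SA.
  have [y [[->|Sy] nB'y] iy] :=
    indepI2 B'n (card_setU1 Sn nSx) iB' iSx.
    by apply: indepI1 iy _ => z [->|/BB']; [left|right].
  by case: (basis_dependent bB' (SA _ Sy) nB'y).
- move=> [/SA/sub_cl //|dS]; have [Ax|Ax] := pselect (A x); first exact: sub_cl.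
  by right; split=> //; exists S.
Qed.

Lemma basis_cl A n S : has_rank M A n -> is_basis M A S -> is_basis M (cl M A) S.
Proof.
move=> An bS; have [iS SA _] := bS.
split=> [//|x /SA/sub_cl //|T iT TA ST].
apply/seteqP; split=> // x Tx.
have [//|dS] := (cl_basisP x An bS).1 (TA x Tx).
by case: dS; apply: indepI1 iT _ => y [->|/ST].
Qed.

Lemma has_rank_cl A n : has_rank M A n -> has_rank M (cl M A) n.
Proof.
by move=> An; have [S bS Sn] := An; exists S => //; exact: basis_cl An bS.
Qed.

Lemma cl_flat A n : has_rank M A n -> is_flat M (cl M A).
Proof.
move=> An; apply: flatP => x; have [S bS Sn] := An.
by rewrite (cl_basisP x (has_rank_cl An) (basis_cl An bS)) -(cl_basisP x An bS).
Qed.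

(** At equal ranks, a basis of [F] would be too large to be extended inside [A],
    so every element of [A] would be in the closure of [F]. *)
Lemma flat_rank_lt F A p q : is_flat M F -> F `<=` A -> ~ (A `<=` F) ->
  has_rank M F p -> has_rank M A q -> (p < q)%N.
Proof.
move=> fF FA nAF Fp Aq; rewrite ltn_neqAle (rank_le Fp Aq FA) andbT.
apply/eqP => E1; apply: nAF => x Ax; rewrite -fF.
rewrite -{}E1 in Aq; have [S bS Sp] := Fp; have [iS SF _] := bS.
apply/(cl_basisP x Fp bS); have [|nSx] := pselect (S x); [by left|right=> iSx].
have [m mp] : exists2 m, (m <= p)%N & (x |` S) #= `I_m.
  by apply: (indep_card Aq iSx) => y [->|/SF/FA].
by rewrite (card_eql (card_setU1 Sp nSx)) => /card_eq_II E1; rewrite -E1 ltnn in mp.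
Qed.

Lemma indep_has_rank S n : indep M S -> S #= `I_n -> has_rank M S n.
Proof. by move=> iS Sn; exists S => //; split=> // T _ TS ST; apply/seteqP. Qed.

Lemma modular_rank F1 F2 p q u i : modular M ->
  is_flat M F1 -> is_flat M F2 ->
  has_rank M F1 p -> has_rank M F2 q -> has_rank M (F1 `|` F2) u ->
  has_rank M (F1 `&` F2) i -> (p + q = u + i)%N.
Proof.
move=> mod f1 f2 [S1 b1 c1] [S2 b2 c2] [Su bu cu] [Si bi ci].
have := mod _ _ f1 f2 _ _ _ _ b1 b2 bu bi.
by rewrite (card_eql (card_sum c1 c2)) (card_eqr (card_sum cu ci)) => /card_eq_II.
Qed.

End Matroid.

(** * Translations and products of flats *)

Section Group.
Context (G : groupType) (M : finitary_matroid G).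
Hypothesis Mtrans : translation_invariant M.
Implicit Types (A B F S T U W : set G) (g x y : G) (m n : nat).
Local Open Scope group_scope.

(* The translate g^-1 A; as a preimage, membership in it unfolds by conversion. *)
Local Notation lquot g A := ( *%g g @^-1` A).

Lemma preimage_mulK g A : lquot g (lquot g^-1 A) = A.
Proof. by apply/seteqP; split=> x /=; rewrite mulKg. Qed.

Lemma preimage_mulVK g A : lquot g^-1 (lquot g A) = A.
Proof. by apply/seteqP; split=> x /=; rewrite mulVKg. Qed.

Lemma image_preimage_mul g A : [set g * x | x in lquot g A] = A.
Proof.
apply/seteqP; split=> [_ [x Ax <-] //|x Ax]; exists (g^-1 * x); last exact: mulVKg.
by rewrite /= mulVKg.
Qed.

Lemma indep_preimage g A : indep M (lquot g A) <-> indep M A.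
Proof. by rewrite -(Mtrans g) image_preimage_mul. Qed.

Lemma basis_preimage g A S : is_basis M A S ->
  is_basis M (lquot g A) (lquot g S).
Proof.
move=> [iS SA maxS]; split; first exact/indep_preimage.
  by move=> x /SA.
move=> T iT TA ST; rewrite -(preimage_mulK g T); congr (_ @^-1` _).
apply: maxS; first exact/indep_preimage.
  by move=> x /TA /=; rewrite mulVKg.
by move=> x Sx; apply: ST; rewrite /= mulVKg.
Qed.

Lemma has_rank_preimage g A n : has_rank M A n ->
  has_rank M (lquot g A) n.
Proof.
move=> [S bS Sn]; exists (lquot g S); first exact: basis_preimage.
apply: card_eq_trans Sn; rewrite -[X in _ #= X](image_preimage_mul g) card_eq_sym.
by apply: inj_card_eq => x y _ _; exact: mulgI.
Qed.

Lemma flat_preimage g F : is_flat M F -> is_flat M (lquot g F).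
Proof.
move=> fF; apply: flatP => x [//|[Fx [B [iB BF dB]]]] /=.
rewrite -fF; right; split=> //; exists (lquot g^-1 B); split.
- exact/indep_preimage.
- by move=> y /BF /=; rewrite mulVKg.
- move=> i1; apply: dB; apply/(indep_preimage g^-1).
  apply: indepI1 i1 _ => y [/= <-|]; last by right.
  by left; rewrite /= mulVKg.
Qed.

(** What being below the submonoid-rank threshold says about each submonoid, so
    that no minimum of extended integers appears in the inequality below. *)
Definition rank_gap n := forall H m, monoid_closed (mem H) -> has_rank M H m ->
  (m <= n)%N -> (m <= 1)%N.

Lemma threshold_rank_gap n : (n%:Z%:E < submonoid_rank_threshold M)%E ->
  rank_gap n.
Proof.
move=> lt_n H m Hmon Hm le_mn; rewrite leqNgt; apply/negP => lt1m.
pose P k := `[< (1 < k)%N /\ exists2 H : set G, monoid_closed (mem H) & has_rank M H k >].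
have exP : exists k, P k by exists m; apply/asboolP; split=> //; exists H.
case: (ex_minnP exP) => k /asboolP Pk mink.
move: lt_n; rewrite /submonoid_rank_threshold /=.
case: xgetP => [r _ [_ lbr]|/(_ k%:Z%:E%E) []].
  have : (r <= m%:Z%:E)%E by apply: lbr; left; exists m => //; split=> //; exists H.
  move=> le_rm /Order.POrderTheory.lt_le_trans /(_ le_rm).
  by rewrite lte_fin ltz_nat ltnNge le_mn.
split; first by left; exists k.
move=> r [[j Pj <-]|->]; last by rewrite leey.
by rewrite lee_fin lez_nat; apply: mink; apply/asboolP.
Qed.

(** * Dyson's transform *)

Section Commutative.
Hypothesis Gabelian : forall x y : G, commute x y.
Hypothesis Mmod : modular M.

Lemma stabilizer_monoid U :
  monoid_closed (mem [set m | forall u, U u -> U (u * m)]).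
Proof.
split=> [|x y]; rewrite !inE /=; first by move=> u; rewrite mulg1.
move=> Ux Uy u /Ux /Uy.
by rewrite mulgA.
Qed.

(** Translates of the flat [F] are flats, so the two factors can be replaced by
    their closures one after the other. *)
Lemma cl_mul_sub F U W : is_flat M F -> (forall u w, U u -> W w -> F (u * w)) ->
  forall u w, cl M U u -> cl M W w -> F (u * w).
Proof.
move=> fF UWF u w clu clw.
have Fcl u' : U u' -> F (u' * w).
  move=> Uu'; apply: (cl_sub_flat (flat_preimage u' fF) _ clw) => w' Ww' /=.
  exact: UWF.
rewrite Gabelian; apply: (cl_sub_flat (flat_preimage w fF) _ clu) => u' /Fcl /=.
by rewrite Gabelian.
Qed.

(** Cauchy-Davenport inequality for flats.  The induction is on the rank of [W]:
    a transform with e[W] not inside [U] lowers it and keeps the sum of the ranks,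
    and if there is none, [W] generates a submonoid inside a translate of [U]. *)
Lemma rank_mul A U W p q n : rank_gap n -> is_flat M A -> has_rank M A n ->
  is_flat M U -> is_flat M W -> has_rank M U p -> has_rank M W q ->
  U !=set0 -> W 1 -> (forall u w, U u -> W w -> A (u * w)) ->
  (p + q <= n.+1)%N.
Proof.
move=> gap fA An.
have [k] := ubnP q; elim: k U W p q => // k IH U W p q ltqk fU fW Up Wq U0 W1 UWA.
have UA : U `<=` A by move=> u Uu; rewrite -[u]mulg1; exact: UWA.
have pn : (p <= n)%N := rank_le Up An UA.
(* Terminal case: no transform changes W, so W lies in the submonoid H. *)
have [stab|] := pselect (forall u w, U u -> W w -> U (u * w)).
  pose H := [set m | forall u, U u -> U (u * m)].
  have [e Ue] := U0.
  have HU : H `<=` lquot e U by move=> m /(_ e Ue).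
  have [m mp Hm] := sub_has_rank (has_rank_preimage e Up) HU.
  have m1 := gap _ _ (stabilizer_monoid U) Hm (leq_trans mp pn).
  have qm : (q <= m)%N.
    by apply: (rank_le Wq Hm) => w Ww u Uu; exact: stab.
  by rewrite -addn1 leq_add // (leq_trans qm).
move=> nstab.
have [e Ue eW] : exists2 e, U e & ~ (W `<=` lquot e U).
  by apply: contrapT => h; apply: nstab => u w Uu Ww; apply: contrapT => nU;
     apply: h; exists u => // /(_ w Ww).
pose eWset := lquot e^-1 W.
pose W' := W `&` lquot e U.
have eWA : eWset `<=` A.
  by move=> x /= Wx; rewrite -(mulVKg e x); exact: UWA.
have UeWA : U `|` eWset `<=` A by rewrite subUset.
have feW : is_flat M eWset := flat_preimage _ fW.
have fW' : is_flat M W' := flatI fW (flat_preimage e fU).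
have W'W : W' `<=` W by move=> x [].
have [p' _ Up'] := sub_has_rank An UeWA.
have [q' _ Wq'] := sub_has_rank Wq W'W.
have ltq' : (q' < q)%N.
  by apply: (flat_rank_lt fW' W'W _ Wq' Wq) => WW'; apply: eW => x /WW' [].
(* The new W' and U `&` eWset are translates of each other by e. *)
have UIeW : has_rank M (U `&` eWset) q'.
  have := has_rank_preimage e^-1 Wq'; congr has_rank.
  by rewrite /W' preimage_setI preimage_mulVK setIC.
have eWq : has_rank M eWset q := has_rank_preimage _ Wq.
(* Modularity: the ranks of the transformed pair have the same sum. *)
rewrite (modular_rank Mmod fU feW Up eWq Up' UIeW).
apply: (IH (cl M (U `|` eWset)) W') => //.
- exact: leq_trans ltq' _.
- exact: cl_flat Up'.
- exact: has_rank_cl.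
- by exists e; apply: sub_cl; left.
- by split=> //=; rewrite mulg1.
move=> u w clu [Ww Uew]; apply: (cl_mul_sub fA _ clu (sub_cl _ (_ : [set w] w))) => //.
move=> {clu}u w' [Uu|eWu] ->; first exact: UWA.
(* For u in eW, commutativity gives u w = (e w) (e^-1 u) with e w in U. *)
rewrite -(mulVKg e u) -mulgA (Gabelian _ w) mulgA; exact: UWA.
Qed.

(** Adjoining 1 to [T] gains the unit that the Cauchy-Davenport inequality
    loses. *)
Lemma indep_pair_bound A B S T k t n : rank_gap n ->
  is_flat M A -> has_rank M A n -> is_flat M B -> ~ B 1 ->
  indep M S -> S #= `I_k -> S !=set0 -> S `<=` A ->
  indep M T -> T #= `I_t -> T `<=` B ->
  (forall a b, S a -> T b -> A (a * b)) -> (k + t <= n)%N.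
Proof.
move=> gap fA An fB B1 iS Sk S0 SA iT Tt TB STA.
have T1 : ~ T 1 by move/TB.
have iT1 : indep M (1 |` T).
  apply: contrapT => dT; apply: (B1); rewrite -fB.
  by right; split=> //; exists T.
have rS := indep_has_rank iS Sk.
have rT := indep_has_rank iT1 (card_setU1 Tt T1).
rewrite -ltnS -addnS.
apply: (rank_mul gap fA An (cl_flat rS) (cl_flat rT)) => //.
- exact: has_rank_cl.
- exact: has_rank_cl.
- by case: S0 => s Ss; exists s; exact: sub_cl.
- by apply: sub_cl; left.
- apply: cl_mul_sub => // s w Ss [->|Tw]; last exact: STA.
  by rewrite mulg1; exact: SA.
Qed.

End Commutative.
End Group.

(** * Matchings *)

Lemma card_enum (T : Type) (S : set T) n : S #= `I_n ->
  exists e : 'I_n -> T, injective e /\ range e = S.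
Proof.
move=> /card_set_bijP[h [hS hI hO]].
have /choice[e eP] (i : 'I_n) : exists x, S x /\ h x = i.
  by have [x Sx hx] := hO i (ltn_ord i); exists x.
exists e; split.
  by move=> i j ij; apply: val_inj; rewrite /= -(eP i).2 -(eP j).2 ij.
apply/seteqP; split=> [_ [i _ <-]|x Sx]; first exact: (eP i).1.
have hx : (h x < n)%N := hS _ Sx.
exists (Ordinal hx) => //; apply: hI; rewrite ?inE //; first exact: (eP _).1.
exact: (eP _).2.
Qed.

Lemma card_image_finset (I : finType) (T : Type) (e : I -> T) (K : {set I}) :
  injective e -> e @` [set` K] #= `I_#|K|.
Proof.
move=> eI.
have -> : e @` [set` K] = range (e \o @enum_val I (mem K)).
  apply/seteqP; split=> [_ [i /= Ki <-]|_ [j _ <-]]; last first.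
    by exists (enum_val j) => //; exact: enum_valP.
  by exists (enum_rank_in Ki i) => //=; rewrite enum_rankK_in.
rewrite (card_eqr card_II); apply: inj_card_eq => i j _ _ /eI.
exact: enum_val_inj.
Qed.

Theorem corollary7p7 (G : groupType) (M : finitary_matroid G)
    (Mtrans : translation_invariant M) (Mmod : modular M)
    (Gabelian : forall x y : G, commute x y)
    (A B : set G) (Aflat : is_flat M A) (Bflat : is_flat M B)
    (n : nat) (rankA : has_rank M A n) (rankB : has_rank M B n)
    (n_lt_mu : (n%:Z%:E < submonoid_rank_threshold M)%E)
    (B_not1 : ~ B 1%g) :
  matched M A B.
Proof.
move=> SA SB bA bB; have [iA SAA _] := bA; have [iB SBB _] := bB.
have [a [aI aS]] := card_enum (basis_card rankA bA).
have [b [bI bS]] := card_enum (basis_card rankB bB).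
pose F i := [set j | `[< ~ A (a i * b j)%g >]]%SET.
have hF : hall_condition F.
  move=> K; have [->|/set0Pn[i0 Ki0]] := eqVneq K finset.set0.
    by rewrite cards0.
  set N := (\bigcup_(i in K) F i)%SET.
  have h : (#|K| + #|(~: N)%SET| <= n)%N.
    apply: (indep_pair_bound Mtrans Gabelian Mmod (S := a @` [set` K])
      (T := b @` [set` (~: N)%SET]) (threshold_rank_gap n_lt_mu) Aflat rankA Bflat B_not1).
    - by apply: indepI1 iA _ => _ [i _ <-]; rewrite -aS; exists i.
    - exact: card_image_finset.
    - by exists (a i0), i0.
    - by move=> _ [i _ <-]; apply: SAA; rewrite -aS; exists i.
    - by apply: indepI1 iB _ => _ [i _ <-]; rewrite -bS; exists i.
    - exact: card_image_finset.
    - by move=> _ [i _ <-]; apply: SBB; rewrite -bS; exists i.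
    - move=> _ _ [i /= Ki <-] [j /= + <-]; rewrite inE => Nj.
      apply: contrapT => nA; move/negP: Nj; apply; apply/finset.bigcupP; exists i => //.
      by rewrite inE; apply/asboolP.
  have := cardsC N; rewrite card_ord => cN.
  by rewrite -(leq_add2r #|(~: N)%SET|) cN.
have [f fI fF] := hall_marriage hF.
(* r inverts a on SA; it takes values in an option because 'I_n may be empty. *)
have /choice[r rP] (x : G) : exists i : option 'I_n, SA x -> exists2 j, i = Some j & a j = x.
  have [|nS] := pselect (SA x); last by exists None.
  by rewrite -aS => -[i _ <-]; exists (Some i) => _; exists i.
exists (fun x => if r x is Some i then b (f i) else 1%g); last first.
  by move=> x /rP [i -> <-]; have := fF i; rewrite inE => /asboolP.
split.
- by move=> x /rP[i -> _]; rewrite -bS; exists (f i).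
- by move=> x y /set_mem /rP[i -> <-] /set_mem /rP[j -> <-] /bI /fI ->.
- rewrite -bS => _ [j _ <-].
  have fbij := injF_bij fI; have [g fg gf] := fbij.
  have SAg : SA (a (g j)) by rewrite -aS; exists (g j).
  exists (a (g j)) => //.
  by have [i -> /aI ->] := rP _ SAg; rewrite gf.
Qed.
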